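(* Let $S$ be a numerical semigroup. If $\mathrm{F}(S)\le 16$ or $\mathrm{g}(S)\le 11$, then $S$ is $\lambda$-minimal.
   Context: $\mathbb{N}=\{0,1,2,\dots\}$. A numerical set is a subset $T\subseteq\mathbb{N}$ with $0\in T$ and finite complement in $\mathbb{N}$. Its gaps are the elements of $\mathrm{G}(T)=\mathbb{N}\setminus T$; the largest gap is the Frobenius number $\mathrm{F}(T)$, and the number of gaps is the genus $\mathrm{g}(T)$. A numerical semigroup is a numerical set closed under addition. The enumeration $\lambda(T)$ of a numerical set $T$ is the integer partition whose Young diagram has as its profile (lower-right boundary) the lattice walk that, for $n=0,1,2,\dots,\mathrm{F}(T)$, takes a unit step right if $n\in T$ and a unit step up if $n\notin T$. Equivalently, the parts of $\lambda(T)$ are the numbers $\#\{u\in T: u<x\}$, one for each gap $x\in\mathrm{G}(T)$. The size $|\lambda|$ of a partition is the sum of its parts. The hook length of a box in the Young diagram of a partition $\lambda$ is the number of boxes to its right in the same row plus the number of boxes below it in the same column plus $1$; $\mathrm{H}(\lambda)$ is the set of all hook lengths of $\lambda$. For a numerical semigroup $S$, $\mathcal{P}(S)=\{\lambda:\mathrm{H}(\lambda)=\mathbb{N}\setminus S\}$; it is known that $\lambda(S)\in\mathcal{P}(S)$. $S$ is $\lambda$-minimal if $|\lambda(S)|\le|\lambda|$ for all $\lambda\in\mathcal{P}(S)$. *)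

(* Defs.v *)
From mathcomp Require Import all_boot finmap.
From mathcomp Require Import boolp classical_sets cardinality.

Set Implicit Arguments.
Unset Strict Implicit.
Unset Printing Implicit Defensive.

Local Open Scope classical_set_scope.

Definition numerical_set (T : set nat) : Prop := T 0 /\ finite_set (~` T).

Definition numerical_semigroup (S : set nat) : Prop :=
  numerical_set S /\ (forall a b : nat, S a -> S b -> S (a + b)).

(* [fset_set] of an infinite set is [fset0], so [gaps], [frobenius], [genus] and
   [enumeration] are meaningful for numerical sets only. *)
Definition gaps (T : set nat) : {fset nat} := fset_set (~` T).

(* For T = nat, which has no gaps, this evaluates to 0; the usual convention is
   -1. *)
Definition frobenius (T : set nat) : nat := \max_(x <- gaps T) x.

Definition genus (T : set nat) : nat := size (gaps T).

Definition is_partition (lam : seq nat) : bool :=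
  sorted geq lam && (0 \notin lam).

Definition partition_size (lam : seq nat) : nat := sumn lam.

(* English convention: box (i, j) lies in row i (counted from the top) and
   column j, and row i has [nth 0 lam i] boxes. *)
Definition young_diagram (lam : seq nat) : set (nat * nat) :=
  [set b | b.2 < nth 0 lam b.1].

Definition arm (lam : seq nat) (b : nat * nat) : nat :=
  #|` fset_set [set c | young_diagram lam c /\ c.1 = b.1 /\ b.2 < c.2]|.

Definition leg (lam : seq nat) (b : nat * nat) : nat :=
  #|` fset_set [set c | young_diagram lam c /\ c.2 = b.2 /\ b.1 < c.1]|.

Definition hook_length (lam : seq nat) (b : nat * nat) : nat :=
  (arm lam b + leg lam b).+1.

Definition hook_set (lam : seq nat) : set nat :=
  hook_length lam @` young_diagram lam.

(* Larger gaps give larger (or equal) parts, so listing the gaps in decreasing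
   order gives the parts in weakly decreasing order. *)
Definition enumeration (T : set nat) : seq nat :=
  [seq #|` fset_set [set u | T u /\ u < x]| | x <- sort geq (gaps T)].

Definition partitions_of_semigroup (S : set nat) : set (seq nat) :=
  [set lam | is_partition lam /\ hook_set lam = ~` S].

Definition lambda_minimal (S : set nat) : Prop :=
  forall lam : seq nat, partitions_of_semigroup S lam ->
    partition_size (enumeration S) <= partition_size lam.

(* Main.v *)
Require Import Defs.
From mathcomp Require Import all_boot finmap zify.
From mathcomp Require Import boolp classical_sets cardinality.

Set Implicit Arguments.
Unset Strict Implicit.
Unset Printing Implicit Defensive.

(** A partition [lam] is the enumeration of a unique numerical set [T], whose
    gaps are the hook lengths of the first column of [lam].  The hook lengths
    of [lam] are exactly the differences [x - t] with [x] a gap and [t] an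
    element of [T], so [hook_set lam = ~` S] says that [S] is the atom monoid
    {n : n + T is contained in T} of [T] ([hook_setP]).  The size of [lam]
    is the weight of [T], the number of pairs (t, x) with t < x, t in [T] and
    x a gap.  One has to show that the atom monoid [S] never weighs more than
    [T].

    If F(S) <= 16, both sets contain every integer above 16, and the
    inequality is checked on all subsets of {0, ..., 16} that contain 0
    ([weight_le_small]).

    If g(S) <= 11 and F = F(S) >= 17, call a gap x of [S] free when F - x is a
    gap too.  The elements of [T] outside [S] are free: F - x in [S] would
    put F in [T].  There are 2 g(S) - F - 1 <= 4 free gaps.  Since a set with g
    gaps weighs the sum of its gaps minus g (g - 1) / 2, adding a set X of k
    elements to [S] does not lower the weight as soon as the average of X is
    at most F / 2 and F + 1 + k <= 2 g(S) ([weight_le_of_average]); the second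
    condition holds because X consists of free gaps.  For the first
    one, pair x with F - x.  An element u > F / 2 of X whose mirror image is not
    in X has some u + t, with t in X, that is free and not in [T]
    ([asymmetric_exit]).  The four gaps u, u + t and their mirror images are
    then all the free gaps, which forces X = {u, F - (u + t)}, of average
    less than F / 2.  If there is no such u, the average is at most F / 2
    by symmetry ([sum_symmetric]). *)

(** * The weight of a set of natural numbers *)

(** The size of the partition enumerating [T], provided that [T] contains every
    integer from [N] on. *)
Definition weight (T : pred nat) (N : nat) : nat :=
  \sum_(x < N | ~~ T x) count T (iota 0 x).

Lemma count_iotaS (p : pred nat) n :
  count p (iota 0 n.+1) = count p (iota 0 n) + p n.
Proof. by rewrite -addn1 iotaD count_cat /= addn0. Qed.

Lemma count_iota_card (p : pred nat) N :
  count p (iota 0 N) = #|[set x : 'I_N | p x]|.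
Proof.
rewrite cardsE -sum1_card -sum1_count -(big_mkord p (fun=> 1)).
by rewrite /index_iota subn0.
Qed.

(** The i-th gap, counted from 0, has exactly i gaps below it. *)
Lemma weightE (T : pred nat) N :
  weight T N + 'C(#|[set x : 'I_N | ~~ T x]|, 2) = \sum_(x < N | ~~ T x) x.
Proof.
rewrite /weight -(count_iota_card (predC T)).
elim: N => [|n IH]; first by rewrite !big_ord0.
rewrite big_mkcond [in RHS]big_mkcond !big_ord_recr -!big_mkcond count_iotaS /=.
rewrite -IH.
have := count_predC T (iota 0 n); rewrite size_iota.
by case: (T n) => /=; rewrite ?addn0 ?addn1 // binS bin1; lia.
Qed.

Lemma two_bin2D m k : 2 * 'C(m + k, 2) = 2 * 'C(m, 2) + k * (2 * m + k.-1).
Proof.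
have two_bin2 n : 2 * 'C(n, 2) + n = n * n.
  by rewrite -mul_bin_diag bin1; case: n => // n; rewrite succnK; lia.
have sqE n : n * n.-1 + n = n * n by case: n => // n; rewrite succnK; lia.
have := two_bin2 (m + k); have := two_bin2 m; have := sqE k; nia.
Qed.

(** Let [T] have m gaps below F + 1, and k = #|X|.  By [weightE], the weights
    differ by k (2 m + k - 1) / 2 minus the sum of X, and the last hypothesis
    says that F <= 2 m + k - 1. *)
Lemma weight_le_of_average (S T : pred nat) (F : nat) :
  (forall n, S n -> T n) ->
  let X := [set x : 'I_F.+1 | T x && ~~ S x] in
  2 * \sum_(x in X) x <= #|X| * F ->
  F.+1 + #|X| <= 2 * #|[set x : 'I_F.+1 | ~~ S x]| ->
  weight S F.+1 <= weight T F.+1.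
Proof.
move=> ST X leX.
have Tn (x : 'I_F.+1) : ~~ S x && ~~ (x \in X) = ~~ T x.
  by rewrite inE; case: (boolP (S x)) => [/ST ->|]; case: (T x).
have Xn (x : 'I_F.+1) : ~~ S x && (x \in X) = (x \in X).
  by rewrite inE; case: (S x); rewrite ?andbF.
have := weightE S F.+1; have := weightE T F.+1.
rewrite [X in _ -> _ = X -> _](bigID [pred x | x \in X]) /=.
rewrite (eq_bigl _ _ Tn) (eq_bigl _ _ Xn).
have -> : [set x : 'I_F.+1 | ~~ S x] = [set x : 'I_F.+1 | ~~ T x] :|: X.
  by apply/finset.setP => x; rewrite !inE; case: (boolP (S x)) => [/ST ->|]; case: (T x).
rewrite cardsU (_ : _ :&: X = finset.set0) ?cards0 ?subn0; last first.
  by apply/finset.setP => x; rewrite !inE; case: (T x).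
move: (#|X|) (#|[set x : 'I_F.+1 | ~~ T x]|) leX => k m leX.
have leF : F.+1 + k <= 2 * (m + k) -> k * F <= k * (2 * m + k.-1).
  by move=> H; apply: leq_mul => //; lia.
have := two_bin2D m k; move: leX leF.
move: ('C(m, 2)) ('C(m + k, 2)) (k * (2 * m + _)) (\sum_(x in X) _) => c d e sX.
by move: (\sum_(x < _ | _) _) (k * F) => sT kF leX leF ? ? ? /leF; lia.
Qed.

(** * Few free gaps *)

(** The contrapositive of: [S] is the set of all n such that n + T is contained
    in [T].  Hook lengths produce it in this form. *)
Definition is_atom_monoid (S T : pred nat) : Type :=
  forall n, reflect (exists2 t, T t & ~~ T (n + t)) (~~ S n).

Section AtomMonoid.

Variables (S T : pred nat) (F : nat).
Hypothesis T0 : T 0.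
Hypothesis Tbig : forall n, F < n -> T n.
Hypothesis gapP : is_atom_monoid S T.
Hypothesis gapF : ~~ S F.

Lemma atom_sub n : S n -> T n.
Proof.
by apply: contraTT => nT; apply/gapP; exists 0; rewrite ?addn0.
Qed.

Lemma atom_add n t : S n -> T t -> T (n + t).
Proof. by move=> Sn Tt; apply: contraTT Sn => nT; apply/gapP; exists t. Qed.

Lemma frobenius_notin : ~~ T F.
Proof.
have /gapP[[|t] _] := gapF; rewrite ?addn0 // addnS.
by rewrite Tbig // ltnS leq_addr.
Qed.

Definition free_gaps : {set 'I_F.+1} := [set x : 'I_F.+1 | ~~ S x & ~~ S (F - x)].

Definition added : {set 'I_F.+1} := [set x : 'I_F.+1 | T x && ~~ S x].

Lemma free_rev x : (rev_ord x \in free_gaps) = (x \in free_gaps).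
Proof. by rewrite !inE /= subSS subKn 1?andbC // -ltnS. Qed.

(** If F - x were in [S], then F = (F - x) + x would be in [T]. *)
Lemma added_free : added \subset free_gaps.
Proof.
apply/fintype.subsetP => x; rewrite !inE => /andP[Tx ->] /=.
apply: contra frobenius_notin => SFx.
by rewrite -(@subnK x F) -1?ltnS // atom_add.
Qed.

(** The gaps and their mirror images cover {0, ..., F}, because two elements
    of [S] cannot add up to F; their intersection is the set of free gaps. *)
Lemma card_free :
  F.+1 + #|free_gaps| = 2 * #|[set x : 'I_F.+1 | ~~ S x]|.
Proof.
set G := [set x : 'I_F.+1 | ~~ S x].
have cG : #|[set rev_ord x | x in G]| = #|G| by apply: card_imset; apply: rev_ord_inj.
have memG x : (x \in [set rev_ord x | x in G]) = ~~ S (F - x).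
  rewrite -[x in LHS]rev_ordK mem_imset; last exact: rev_ord_inj.
  by rewrite inE /= subSS.
have := cardsUI G [set rev_ord x | x in G].
have -> : G :|: [set rev_ord x | x in G] = [set: 'I_F.+1].
  apply/finset.setP => x; rewrite finset.in_setU memG !inE -negb_and.
  apply: contra gapF => /andP[Sx SFx].
  apply/negPn/negP => /gapP[t Tt].
  have xF : x <= F by rewrite -ltnS.
  by rewrite -(subnKC xF) -addnA !atom_add.
have -> : G :&: [set rev_ord x | x in G] = free_gaps.
  by apply/finset.setP => x; rewrite finset.in_setI memG !inE.
by rewrite cardsT card_ord cG mul2n -addnn.
Qed.

(** Adding the contributions of x and F - x, the sum over X of 2 x - F becomes
    half the sum over all x of the products
    ((x in X) - (F - x in X)) (2 x - F), and the hypothesis makes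
    each of them nonpositive. *)
Lemma sum_symmetric (X : {set 'I_F.+1}) :
  (forall x : 'I_F.+1, x \in X -> F < 2 * x -> rev_ord x \in X) ->
  2 * \sum_(x in X) x <= #|X| * F.
Proof.
move=> symX.
pose f (x : 'I_F.+1) : nat := x \in X.
have sumE (h : 'I_F.+1 -> nat) : \sum_(x in X) h x = \sum_x f x * h x.
  by rewrite big_mkcond; apply: eq_bigr => x _; rewrite /f; case: ifP; rewrite ?mul1n.
have -> : #|X| * F = \sum_(x in X) F by rewrite sum_nat_const.
rewrite big_distrr /= !sumE -(leq_pmul2l (isT : 0 < 2)) mul2n -addnn mul2n -addnn.
rewrite [X in _ + X <= _](reindex_inj rev_ord_inj).
rewrite [X in _ <= _ + X](reindex_inj rev_ord_inj) -!big_split /=.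
apply: leq_sum => x _; rewrite subSS /f.
have xF : x <= F by rewrite -ltnS.
have := symX x; have := symX (rev_ord x); rewrite rev_ordK /= subSS.
case: (x \in X); case: (rev_ord x \in X) => /= h1 h2; lia.
Qed.

(** As u is not in [S], some u + t is outside [T], with t in [T].  This gap is
    free: if F - (u + t) were in [S], adding t would put F - u in [T].  And t is
    not in [S], as otherwise u + t would be in [T]. *)
Lemma asymmetric_exit (u : 'I_F.+1) :
  u \in added -> rev_ord u \notin added ->
  exists t y : 'I_F.+1,
    [/\ t \in added, y \in free_gaps :\: added, 0 < t & y = u + t :> nat].
Proof.
move=> Xu nXu.
have uF : u <= F by rewrite -ltnS.
have := fintype.subsetP added_free u Xu; rewrite inE => /andP[_ nSFu].
have nTFu : ~~ T (F - u).
  by apply: contra nXu => TFu; rewrite inE /= subSS TFu.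
move: Xu; rewrite inE => /andP[Tu nSu].
have /gapP[t Tt nTut] := nSu.
have utF : u + t <= F by rewrite leqNgt; apply: contra nTut => /Tbig.
have nSut : ~~ S (u + t) by apply: contra nTut => /atom_sub.
have nSF : ~~ S (F - (u + t)).
  apply: contra nTFu => SFut.
  by rewrite (_ : F - u = F - (u + t) + t) ?atom_add //; lia.
have tF : t < F.+1 by rewrite ltnS (leq_trans (leq_addl u t)).
exists (Ordinal tF), (Ordinal (utF : u + t < F.+1)); split=> //.
- rewrite inE Tt /=; apply: contra nTut => St.
  by rewrite addnC atom_add.
- by rewrite !inE /= nSut nSF (negbTE nTut).
- by rewrite lt0n; apply: contraNneq nTut => /= ->; rewrite addn0.
Qed.

Lemma sum_added_le : #|free_gaps| <= 4 -> 2 * \sum_(x in added) x <= #|added| * F.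
Proof.
move=> free4.
case: (pickP [pred u : 'I_F.+1 | [&& u \in added, F < 2 * u & rev_ord u \notin added]]).
  move=> u /and3P[Xu Fu nXu].
  have [t [y [Xt /finset.setDP[Wy nXy] t0 yE]]] := asymmetric_exit Xu nXu.
  have uF : u <= F by rewrite -ltnS.
  have yF : y <= F by rewrite -ltnS.
  have Wu := fintype.subsetP added_free u Xu.
  (* F - y < F - u < u < y are four distinct free gaps. *)
  have freeE : [set u; rev_ord u; y; rev_ord y] = free_gaps.
    apply/eqP; rewrite eqEcard; apply/andP; split.
      by rewrite !finset.subUset !finset.sub1set !free_rev Wu Wy.
    apply: leq_trans free4 _.
    rewrite -!finset.setUA !cardsU1 cards1 !inE -!val_eqE /= !subSS; lia.
  have addedE : added \subset [set u; rev_ord y].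
    apply/fintype.subsetP => x Xx; have := fintype.subsetP added_free x Xx.
    rewrite -freeE !inE => /orP[/orP[/orP[->//|]|]|->]; last by rewrite orbT.
      by move=> /eqP xE; rewrite xE (negbTE nXu) in Xx.
    by move=> /eqP xE; rewrite xE (negbTE nXy) in Xx.
  (* t = u would give y = 2 u > F. *)
  have tE : t = rev_ord y.
    have := fintype.subsetP addedE t Xt; rewrite !inE => /orP[/eqP tu|/eqP //].
    by move: yE; rewrite tu; lia.
  have -> : added = [set u; rev_ord y].
    by apply/eqP; rewrite finset.eqEsubset addedE /= finset.subUset !finset.sub1set Xu -tE Xt.
  have uy : u != rev_ord y by rewrite -val_eqE /= subSS; lia.
  by rewrite cards2 uy big_setU1 ?inE //= big_set1 /= subSS; lia.
move=> sym; apply: sum_symmetric => x Xx Fx.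
by have := sym x; rewrite /= Xx Fx /= => /negbFE.
Qed.

Lemma weight_le_few_free : #|free_gaps| <= 4 -> weight S F.+1 <= weight T F.+1.
Proof.
move=> free4; apply: weight_le_of_average; first exact: atom_sub.
  exact: sum_added_le.
by rewrite -card_free leq_add2l subset_leq_card // added_free.
Qed.

End AtomMonoid.

(** * Frobenius number at most 16 *)

(** In this part the list of the values of a predicate at 0, ..., N - 1 stands
    for a set that contains every integer from N on. *)
Fixpoint bits_sub (l r : seq bool) : bool :=
  match l, r with
  | a :: l', b :: r' => (a ==> b) && bits_sub l' r'
  | _, _ => true
  end.

(** The atom monoid: an element shifted past the end of the list lands in the
    set, so [bits_sub] only compares up to the end of the shorter list. *)
Definition bits_atoms (l : seq bool) : seq bool :=
  mkseq (fun n => bits_sub l (drop n l)) (size l).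

(** The accumulator [c] counts the elements met so far, so that the weight is
    found in one traversal. *)
Fixpoint bits_weight (c : nat) (l : seq bool) : nat :=
  match l with
  | [::] => 0
  | b :: l' => if b then bits_weight c.+1 l' else c + bits_weight c l'
  end.

Fixpoint all_bits (n : nat) (p : pred (seq bool)) : bool :=
  match n with
  | 0 => p [::]
  | n'.+1 => all_bits n' (fun l => p (true :: l)) &&
             all_bits n' (fun l => p (false :: l))
  end.

Definition bits_minimal (l : seq bool) : bool :=
  bits_weight 0 (bits_atoms l) <= bits_weight 0 l.

Lemma all_bitsP n p l : all_bits n p -> size l = n -> p l.
Proof.
elim: n p l => [|n IH] p [|b l] //= /andP[pt pf] [sl].
by case: b; [exact: IH pt sl | exact: IH pf sl].
Qed.

(** Every subset of {0, ..., 16} that contains 0 is tested; a set with a smaller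
    Frobenius number is represented by a list ending with [true]. *)
Lemma all_bits_minimal : all_bits 16 (fun l => bits_minimal (true :: l)).
Proof. by vm_compute. Qed.

Lemma bits_minimal17 l : size l = 17 -> head false l -> bits_minimal l.
Proof.
case: l => [|[] l] // sl _.
have {}sl : size l = 16 by case: sl.
exact: (all_bitsP all_bits_minimal sl).
Qed.

Lemma bits_subP (l r : seq bool) : size r <= size l ->
  reflect (forall i, i < size r -> nth false l i -> nth false r i) (bits_sub l r).
Proof.
elim: l r => [|a l IH] [|b r] //= => [_|_|]; try by constructor.
rewrite ltnS => /IH {}IH; apply: (iffP andP) => [[ab /IH lr] [|i]|H].
- by move=> _; apply/implyP.
- exact: lr.
- by split; [apply/implyP; exact: (H 0) | apply/IH => i; exact: (H i.+1)].
Qed.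

Lemma bits_weightE (T : pred nat) N :
  bits_weight 0 (map T (iota 0 N)) = weight T N.
Proof.
have gen n a : bits_weight (count T (iota 0 a)) (map T (iota a n)) =
    \sum_(a <= x < a + n | ~~ T x) count T (iota 0 x).
  elim: n a => [|n IH] a; first by rewrite addn0 big_geq.
  rewrite big_ltn_cond ?addnS ?ltnS ?leq_addr //= -addSn -IH count_iotaS.
  by case: (T a); rewrite ?addn0 ?addn1.
by rewrite (gen N 0) add0n big_mkord.
Qed.

Lemma bits_atomsE (S T : pred nat) F :
  (forall n, F < n -> T n) ->
  is_atom_monoid S T ->
  bits_atoms (map T (iota 0 F.+1)) = map S (iota 0 F.+1).
Proof.
move=> Tbig gapP; rewrite /bits_atoms /mkseq size_map size_iota.
apply/eq_in_map => n; rewrite mem_iota add0n ltnS => nF; cbv beta.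
have nthT i : i < F.+1 -> nth false (map T (iota 0 F.+1)) i = T i.
  by move=> iF; rewrite (nth_map 0) ?size_iota ?nth_iota.
have szT : size (map T (iota 0 F.+1)) = F.+1 by rewrite size_map size_iota.
apply/bits_subP/idP => [|H|Sn i]; first by rewrite size_drop leq_subr.
  apply: contraTT isT => /gapP[t Tt nT].
  have ntF : n + t < F.+1 by rewrite ltnNge; apply: contra nT => /Tbig.
  move: (H t); rewrite size_drop szT nth_drop !nthT //; last by lia.
  by rewrite Tt (negbTE nT) => /(_ ltac:(lia) isT).
rewrite size_drop szT nth_drop => iF; rewrite !nthT; [|lia|lia].
by move=> Ti; apply: contraTT Sn => nT; apply/gapP; exists i.
Qed.

Lemma weight_le_small (S T : pred nat) :
  T 0 -> (forall n, 16 < n -> T n) ->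
  is_atom_monoid S T ->
  weight S 17 <= weight T 17.
Proof.
move=> T0 Tbig gapP; rewrite -!bits_weightE -(bits_atomsE Tbig gapP).
by apply: bits_minimal17; rewrite ?size_map ?size_iota.
Qed.

(** * Partitions and numerical sets *)

(** The hook lengths of the first column of the Young diagram, which are the
    gaps of the numerical set enumerated by [lam]. *)
Fixpoint first_column (lam : seq nat) : seq nat :=
  if lam is p :: l then p + size l :: first_column l else [::].

(** The element of the numerical set attached to column [j]: on the profile
    of the diagram, [j] right steps come before the one below this column, and
    one up step for each row of length at most [j]. *)
Definition column_label (lam : seq nat) (j : nat) : nat :=
  j + count (fun p => p <= j) lam.

Lemma size_first_column lam : size (first_column lam) = size lam.
Proof. by elim: lam => //= p l ->. Qed.

Lemma sorted_geq_cons p l :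
  sorted geq (p :: l) -> all (geq p) l /\ sorted geq l.
Proof.
move=> sl; split; last exact: path_sorted sl.
by apply: order_path_min sl => a b c /= ba ac; apply: leq_trans ac ba.
Qed.

Lemma first_column_lt p l x :
  all (geq p) l -> x \in first_column l -> x < p + size l.
Proof.
elim: l => //= q l IH /andP[qp lp]; rewrite inE => /orP[/eqP ->|/(IH lp)].
  by rewrite addnS ltnS leq_add2r.
by rewrite addnS => /ltnW; rewrite ltnS.
Qed.

Lemma first_column_uniq lam : sorted geq lam -> uniq (first_column lam).
Proof.
elim: lam => //= p l IH /sorted_geq_cons[lp /IH ->]; rewrite andbT.
by apply/negP => /(first_column_lt lp); rewrite ltnn.
Qed.

Lemma sumn_first_column lam :
  sumn (first_column lam) = sumn lam + 'C(size lam, 2).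
Proof. by elim: lam => //= p l ->; rewrite binS bin1; lia. Qed.

Lemma count_le_all p l j : all (geq p) l -> p <= j ->
  count (fun q => q <= j) l = size l.
Proof.
move=> lp pj; apply/eqP; rewrite -all_count.
by apply: sub_all lp => q /= /leq_trans; apply.
Qed.

(** A new first row of length p leaves the labels of columns j < p unchanged
    and increases by one the labels of columns j >= p, which were all the integers
    from p + size l on; so it removes the label p + size l, and this is
    the new first column hook. *)
Lemma column_label_notin lam j :
  sorted geq lam -> column_label lam j \notin first_column lam.
Proof.
elim: lam => //= p l IH /sorted_geq_cons[lp /IH {IH}].
rewrite /column_label /= inE negb_or => nl; apply/andP; split.
  case: (leqP p j) => pj; first by rewrite (count_le_all lp pj); lia.
  by have := count_size (fun q => q <= j) l; lia.
case: (leqP p j) => pj; last by rewrite add0n.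
apply/negP => /(first_column_lt lp); rewrite (count_le_all lp pj); lia.
Qed.

Lemma column_label_surj lam t :
  sorted geq lam -> t \notin first_column lam -> exists j, t = column_label lam j.
Proof.
elim: lam t => [|p l IH] t /=; first by exists t; rewrite /column_label addn0.
move=> /sorted_geq_cons[lp sl]; rewrite inE negb_or => /andP[tp tl].
case: (ltnP t (p + size l)) => tlt.
  have [j tE] := IH t sl tl; exists j; rewrite tE /column_label /=.
  case: (leqP p j) => pj //.
  by move: tE; rewrite /column_label (count_le_all lp pj); lia.
exists (t - (size l).+1); rewrite /column_label /=.
by rewrite (count_le_all lp); lia.
Qed.

(** Thus the hook length of box (i, j) is the difference between the gap of row
    i and the label of column j: the rows that count towards the leg and those
    that count towards the label are complementary among the rows below i. *)
Lemma first_column_hook lam i j : sorted geq lam -> j < nth 0 lam i ->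
  nth 0 (first_column lam) i =
  (nth 0 lam i - j.+1 + count (fun p => j < p) (drop i.+1 lam)).+1 +
    column_label lam j.
Proof.
rewrite /column_label.
elim: lam i => [|p l IH] [|i] //= /sorted_geq_cons[lp sl] ji.
  rewrite drop0 leqNgt ji /= add0n.
  have := count_predC (fun q => j < q) l.
  rewrite (eq_count (a1 := predC _) (a2 := fun q => q <= j)); first by lia.
  by move=> q /=; rewrite -leqNgt.
rewrite (IH i sl ji) leqNgt; case: (leqP p j) => // pj.
have il : i < size l by case: (ltnP i (size l)) ji => // /(nth_default 0) ->.
have := allP lp _ (mem_nth 0 il); rewrite /= => ?; lia.
Qed.

Lemma column_label_lt lam i j : sorted geq lam -> i < size lam ->
  column_label lam j < nth 0 (first_column lam) i -> j < nth 0 lam i.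
Proof.
rewrite /column_label.
elim: lam i => [|p l IH] [|i] //= /sorted_geq_cons[lp sl] il.
  by case: (ltnP j p) => // pj; rewrite (count_le_all lp pj); lia.
by move=> lt; apply: IH => //; lia.
Qed.

Lemma armE lam i j : arm lam (i, j) = nth 0 lam i - j.+1.
Proof.
rewrite /arm /young_diagram /=.
set s := [seq (i, b) | b <- iota j.+1 (nth 0 lam i - j.+1)].
have -> : [set c | c.2 < nth 0 lam c.1 /\ c.1 = i /\ j < c.2]%classic =
          [set` [fset c in s]%fset]%classic.
  apply/seteqP; split => [[a b]|[a b]] /=; rewrite !inE.
    by case=> bi [ai jb]; subst a; apply/mapP; exists b; rewrite // mem_iota; lia.
  by case/mapP => b'; rewrite mem_iota => H [-> ->]; lia.
rewrite set_fsetK card_fseq undup_id ?size_map ?size_iota //.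
by rewrite map_inj_uniq ?iota_uniq // => ? ? [].
Qed.

Lemma legE lam i j : leg lam (i, j) = count (fun p => j < p) (drop i.+1 lam).
Proof.
rewrite /leg /young_diagram /=.
set r := iota i.+1 (size lam - i.+1).
set s := [seq (a, j) | a <- r & j < nth 0 lam a].
have -> : [set c | c.2 < nth 0 lam c.1 /\ c.2 = j /\ i < c.1]%classic =
          [set` [fset c in s]%fset]%classic.
  apply/seteqP; split => [[a b]|[a b]] /=; rewrite !inE.
    case=> ja [bj ia]; subst b; apply/mapP; exists a => //.
    rewrite mem_filter ja mem_iota.
    have al : a < size lam by case: (ltnP a (size lam)) ja => // /(nth_default 0) ->.
    lia.
  by case/mapP => a'; rewrite mem_filter mem_iota => H [-> ->]; lia.
rewrite set_fsetK card_fseq undup_id ?size_map; last first.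
  by rewrite map_inj_uniq ?filter_uniq ?iota_uniq // => ? ? [].
rewrite size_filter.
have -> : drop i.+1 lam = map (nth 0 lam) r.
  apply: (@eq_from_nth _ 0); first by rewrite size_drop size_map size_iota.
  move=> k; rewrite size_drop => kl.
  by rewrite nth_drop (nth_map 0) ?size_iota // nth_iota.
by rewrite count_map.
Qed.

(** Every element of the numerical set is a column label, and a label smaller
    than the gap of row i belongs to a column that meets row i, so that their
    difference is the hook length of a box. *)
Lemma hook_setP lam n : sorted geq lam ->
  hook_set lam n <->
  exists2 t, t \notin first_column lam & n + t \in first_column lam.
Proof.
move=> sl; split.
  case=> [[i j]] /= ji <-.
  exists (column_label lam j); first exact: column_label_notin.
  rewrite /hook_length armE legE -first_column_hook // mem_nth //.
  rewrite size_first_column.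
  by case: (ltnP i (size lam)) ji => // /(nth_default 0); rewrite /young_diagram /= => ->.
case=> t nt /(nthP 0)[i il xE].
have [j tE] := column_label_surj sl nt; subst t.
have n0 : 0 < n.
  rewrite lt0n; apply: contraNneq nt => n0.
  by rewrite n0 add0n in xE; rewrite -xE mem_nth.
rewrite size_first_column in il.
have ji : j < nth 0 lam i.
  by apply: column_label_lt => //; rewrite xE; lia.
exists (i, j) => //.
apply: (@addIn (column_label lam j)).
by rewrite -xE (first_column_hook sl ji) /hook_length armE legE.
Qed.

Lemma sum_ord_seq (s : seq nat) (f : nat -> nat) N :
  uniq s -> (forall x, x \in s -> x < N) ->
  \sum_(x < N | (x : nat) \in s) f x = \sum_(x <- s) f x.
Proof.
move=> us sN; rewrite -(big_mkord (fun x => x \in s)) -big_filter.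
apply: perm_big; apply: uniq_perm; rewrite ?filter_uniq ?iota_uniq // => x.
by rewrite mem_filter mem_index_iota /=; apply/andb_idr => /sN.
Qed.

(** By [weightE], both sides are the sum of the first column hooks minus a
    binomial coefficient. *)
Lemma weight_first_column lam N : sorted geq lam ->
  (forall x, x \in first_column lam -> x < N) ->
  weight (fun x => x \notin first_column lam) N = sumn lam.
Proof.
move=> sl sN; have us := first_column_uniq sl.
have := weightE (fun x => x \notin first_column lam) N.
have E (f : nat -> nat) : \sum_(x < N | ~~ ((x : nat) \notin first_column lam)) f x =
    \sum_(x <- first_column lam) f x.
  by rewrite -(sum_ord_seq f us sN); apply: eq_bigl => x; rewrite negbK.
rewrite (E (fun x => x)) -sumnE sumn_first_column -(size_first_column lam) -sum1_card.
under eq_bigl do rewrite inE.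
by rewrite (E (fun=> 1)) sum1_size => /addIn.
Qed.

(** * Enumeration, genus and Frobenius number *)

Lemma in_gaps (S : set nat) n :
  numerical_set S -> (n \in gaps S) = ~~ `[< S n >].
Proof.
case=> _ fS; rewrite in_fset_set //.
by apply/idP/asboolPn => [/set_mem|/(@mem_set _ (~` S)%classic)].
Qed.

Lemma size_enumeration (S : set nat) N : numerical_set S ->
  (forall x, x \in gaps S -> x < N) ->
  partition_size (enumeration S) = weight (fun n => `[< S n >]) N.
Proof.
move=> nS SN.
rewrite /partition_size /enumeration sumnE big_map (perm_big (gaps S)) /=; last first.
  by rewrite perm_sort.
have partE x : #|` fset_set [set u | S u /\ u < x]%classic| =
    count (fun n => `[< S n >]) (iota 0 x).
  have -> : [set u | S u /\ u < x]%classic =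
      [set` [fset u in [seq n <- iota 0 x | `[< S n >]]]%fset]%classic.
    apply/seteqP; split => u /=; rewrite !inE mem_filter mem_iota leq0n add0n /=.
      by case=> Su ux; apply/andP; split=> //; apply/asboolP.
    by move=> /andP[/asboolP Su ux].
  by rewrite set_fsetK card_fseq undup_id ?filter_uniq ?iota_uniq // size_filter.
rewrite (eq_bigr _ (fun x _ => partE x)) -(sum_ord_seq _ (fset_uniq _) SN).
by apply: eq_bigl => x; rewrite in_gaps.
Qed.

Lemma gaps_le_frobenius (S : set nat) x : x \in gaps S -> x <= frobenius S.
Proof. by move=> xS; apply: (@leq_bigmax_seq _ _ xpredT id). Qed.

Lemma bigmax_mem (s : seq nat) : 0 < \max_(x <- s) x -> \max_(x <- s) x \in s.
Proof.
elim: s => [|x s IH]; first by rewrite big_nil.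
rewrite big_cons inE; case: (leqP x (\max_(y <- s) y)) => xs.
  by move=> /IH ->; rewrite orbT.
by rewrite eqxx.
Qed.

Lemma frobenius_gap (S : set nat) : 0 < frobenius S -> frobenius S \in gaps S.
Proof. exact: bigmax_mem. Qed.

Lemma genus_card (S : set nat) N : numerical_set S ->
  (forall x, x \in gaps S -> x < N) ->
  genus S = #|[set x : 'I_N | ~~ `[< S x >]]|.
Proof.
move=> nS SN; rewrite /genus -sum1_size -(sum_ord_seq _ (fset_uniq _) SN) -sum1_card.
by apply: eq_bigl => x; rewrite in_gaps // inE.
Qed.

(** * Small numerical semigroups *)

Theorem proposition1p1 (S : set nat) (hS : numerical_semigroup S) :
  frobenius S <= 16 \/ genus S <= 11 -> lambda_minimal S.
Proof.
case: hS => nS _ small lam [/andP[sl lam0] hookE].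
pose Sb n := `[< S n >].
pose T n := n \notin first_column lam.
have gapP : is_atom_monoid Sb T.
  move=> n; rewrite /Sb -asbool_neg.
  apply: (iffP (asboolP _)); have := hook_setP n sl; rewrite hookE /=.
    by case=> H _ /H[t ? ?]; exists t => //; rewrite negbK.
  by case=> _ H [t ? tt]; apply: H; exists t => //; rewrite negbK in tt.
have T0 : T 0.
  rewrite /T; elim: (lam) lam0 => //= p l IH; rewrite !inE !negb_or => /andP[p0 /IH ->].
  by rewrite andbT eq_sym addn_eq0 negb_and eq_sym p0.
have Tbig N : (forall x, x \in gaps S -> x < N) -> forall n, N <= n -> T n.
  move=> SN n Nn; apply: contraT => nT.
  have : ~~ Sb n by apply/gapP; exists 0; rewrite ?addn0.
  by rewrite -in_gaps // => /SN; rewrite ltnNge Nn.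
have main N : (forall x, x \in gaps S -> x < N) -> weight Sb N <= weight T N ->
    partition_size (enumeration S) <= partition_size lam.
  move=> SN; rewrite -(size_enumeration nS SN) weight_first_column // => x xl.
  by rewrite ltnNge; apply: contraL xl => /(Tbig N SN).
have SF x : x \in gaps S -> x < (frobenius S).+1 by move=> /gaps_le_frobenius.
case: (leqP (frobenius S) 16) => F16.
  have S17 x : x \in gaps S -> x < 17 by move=> /SF /leq_trans; apply; exact: F16.
  by apply: (main 17 S17); apply: weight_le_small => //; exact: Tbig S17.
have g11 : genus S <= 11 by case: small => // /(leq_trans F16); rewrite ltnn.
have gapF : ~~ Sb (frobenius S).
  by rewrite -in_gaps // frobenius_gap //; apply: leq_trans F16.
apply: (main _ SF); apply: weight_le_few_free => //; first exact: Tbig SF.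
have := card_free gapP gapF; rewrite -(genus_card nS SF); lia.
Qed.
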